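(* Let $G$ be a $D$-regular finite connected graph of diameter $L$. The following are equivalent: - $G$ is self-centered and Bonnet-Myers sharp. - $G$ is self-centered and satisfies $\Lambda\left(\frac{2D}{L}-2\right)$. Moreover, if any of these equivalent properties holds, then every edge of $G$ lies in precisely $\frac{2D}{L}-2$ triangles.
   Context: All graphs are finite, simple, undirected, unweighted, connected, and have at least one edge. $d$ denotes the combinatorial distance and $\mathrm{diam}(G)=\max_{x,y}d(x,y)$; $x\sim y$ means that $x,y$ are adjacent; $N_x$ is the set of neighbours of $x$ and $N_{xy}=N_x\cap N_y$. A graph $G$ is self-centered if for every vertex $x$ there is a vertex $\overline x$ with $d(x,\overline x)=\mathrm{diam}(G)$. For a $D$-regular graph $G=(V,E)$ and $x\in V$, let $\mu_x$ be the probability measure on $V$ giving mass $\frac1{D+1}$ to $x$ and to each of its $D$ neighbours. The Wasserstein distance of probability measures $\mu,\nu$ on $V$ is $W_1(\mu,\nu)=\inf_\pi\sum_{u,v\in V}d(u,v)\pi(u,v)$, where $\pi:V\times V\to[0,1]$ runs over all couplings with marginals $\mu$ and $\nu$. The (modified) Ollivier Ricci curvature of two different vertices $x,y$ is $$\kappa(x,y)=\frac{D+1}{D}\left(1-\frac{W_1(\mu_x,\mu_y)}{d(x,y)}\right).$$ A $D$-regular graph $G$ of diameter $L$ is called Bonnet-Myers sharp if $\inf_{x\sim y}\kappa(x,y)=\frac2L$. A regular graph $G$ satisfies $\Lambda(m)$ at an edge $e=\{x,y\}$ if (i) $e$ is contained in at least $m$ triangles and (ii) there is a perfect matching (consisting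 of edges of $G$) between the neighbours of $x$ and the neighbours of $y$ not involved in these triangles, i.e. between $N_x\setminus(N_{xy}\cup\{y\})$ and $N_y\setminus(N_{xy}\cup\{x\})$. $G$ satisfies $\Lambda(m)$ if it satisfies $\Lambda(m)$ at each edge. *)

(* Defs.v *)
From HB Require Import structures.
From mathcomp Require Import all_boot all_order all_algebra.
From mathcomp Require Import boolp classical_sets reals.

Set Implicit Arguments.
Unset Strict Implicit.
Unset Printing Implicit Defensive.

Import Order.TTheory GRing.Theory Num.Theory.
Local Open Scope ring_scope.

(* A graph is an adjacency relation on a finite type. *)

Definition simple_graph (T : finType) (e : rel T) : Prop :=
  symmetric e /\ irreflexive e.

Definition connected_graph (T : finType) (e : rel T) : Prop :=
  forall x y : T, connect e x y.

Definition has_edge (T : finType) (e : rel T) : Prop := exists x y : T, e x y.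

Definition nbhd (T : finType) (e : rel T) (x : T) : {set T} :=
  [set y | e x y]%SET.

Definition regular (T : finType) (e : rel T) (D : nat) : Prop :=
  forall x : T, #|nbhd e x| = D.

(* A shortest walk has fewer than #|T| edges, so the bound on n loses nothing;
   the default value #|T| is only taken when x and y are not connected. *)
Definition dist (T : finType) (e : rel T) (x y : T) : nat :=
  \big[minn/#|T|]_(n < #|T| |
      [exists p : n.-tuple T, path e x p && (last x p == y)]) n.

Definition diam (T : finType) (e : rel T) : nat :=
  (\max_(x : T) \max_(y : T) dist e x y)%N.

Definition self_centered (T : finType) (e : rel T) : Prop :=
  forall x : T, exists x' : T, dist e x x' = diam e.

Section Curvature.

Variables (R : realType) (T : finType) (e : rel T).

Definition mu (D : nat) (x : T) : T -> R :=
  fun z => if (z == x) || e x z then D.+1%:R^-1 else 0.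

Definition coupling (m n : T -> R) (p : T -> T -> R) : Prop :=
  [/\ forall u v, 0 <= p u v <= 1,
      forall u, \sum_(v : T) p u v = m u
    & forall v, \sum_(u : T) p u v = n v].

Definition W1 (m n : T -> R) : R :=
  inf [set c : R | exists2 p : T -> T -> R, coupling m n p &
         c = \sum_(u : T) \sum_(v : T) (dist e u v)%:R * p u v]%classic.

Definition kappa (D : nat) (x y : T) : R :=
  D.+1%:R / D%:R * (1 - W1 (mu D x) (mu D y) / (dist e x y)%:R).

Definition Bonnet_Myers_sharp (D : nat) : Prop :=
  inf [set k : R | exists x y : T, e x y /\ k = kappa D x y]%classic
  = 2 / (diam e)%:R.

End Curvature.

Section Lambda.

Variables (T : finType) (e : rel T).

Definition triangles (x y : T) : {set {set T}} :=
  [set t : {set T} | [&& #|t| == 3%N, x \in t, y \in t &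
     [forall u in t, forall v in t, (u != v) ==> e u v]]]%SET.

Definition common_nbhd (x y : T) : {set T} := nbhd e x :&: nbhd e y.

(* M is a set of edges between A and B that are pairwise disjoint and cover
   all the vertices of A and B. *)
Definition perfect_matching (A B : {set T}) (M : {set {set T}}) : Prop :=
  [/\ forall E, E \in M ->
        exists u v, [/\ u \in A, v \in B, e u v & E = [set u; v]%SET],
      finset.trivIset M
    & finset.cover M = A :|: B].

(* m is a scalar, not a natural number: 2D/L - 2 is a priori neither an integer
   nor nonnegative. *)
Definition Lambda_at (R : realType) (m : R) (x y : T) : Prop :=
  m <= #|triangles x y|%:R /\
  exists M : {set {set T}},
    perfect_matching (nbhd e x :\: (common_nbhd x y :|: [set y]%SET))
                     (nbhd e y :\: (common_nbhd x y :|: [set x]%SET)) M.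

Definition Lambda (R : realType) (m : R) : Prop :=
  forall x y : T, e x y -> Lambda_at m x y.

End Lambda.

(* Main.v *)
Require Import Defs.
From HB Require Import structures.
From mathcomp Require Import boolp classical_sets reals.
From mathcomp Require Import all_boot all_order all_algebra.
From mathcomp Require Import lra.

Import Order.TTheory GRing.Theory Num.Theory.
Local Open Scope ring_scope.

Set Implicit Arguments.
Unset Strict Implicit.
Unset Printing Implicit Defensive.

(** For adjacent [x] and [y] the masses of [mu x] and [mu y] on
    [{x, y} :|: common_nbhd e x y] cancel, and what remains to be moved is one
    unit of mass [1 / (D + 1)] from each private neighbour of [x] to the private
    neighbours of [y].  A perfect matching between these two sets of size [n]
    moves every unit by distance 1, so [(D + 1) W1 <= n] ([W1_matching]).
    Conversely, a violation of Hall's condition yields an explicit 1-Lipschitz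
    function whose means differ by more than [n / (D + 1)], so the inequality
    forces a perfect matching ([matching_of_W1]).  Since [D = t + n + 1] for an
    edge in [t] triangles, the inequality reads [(t + 2) / D <= kappa x y].  This
    already shows that [Lambda (2D/L - 2)] implies [2 / L <= kappa] on all edges.

    The global input is a Laplacian comparison.  Assume [K <= kappa] on all edges
    and write [S f x] for the sum of [f] over the closed ball of radius 1 at [x].
    For 1-Lipschitz [f], easy Kantorovich duality says that [S f] changes by at
    most [D + 1 - K D] along an edge.  With [f] the distance from [x0] and
    walking from [x0], where [S f x0 = D], one gets
      [S f x <= D + (D + 1 - K D) d(x0, x)]      ([sum_ball_dist]).
    At distance [L] from [x0] this gives the Bonnet-Myers bound [K <= 2 / L]
    ([bonnet_myers]), so that [2 / L <= kappa] on all edges means sharpness.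

    If [K = 2 / L] and [x'] is at distance [L] from [x], add the bounds for the
    distances from [x] and from [x'].  The sum [g >= L] of the two distances
    satisfies [S g <= (D + 1) g - (2 D / L) (g - L)], while [S g] and [(D + 1) g]
    have the same total over the graph by regularity.  Hence [g = L] and every
    comparison is an equality ([antipodal_equality]).  Evaluated at a neighbour
    [y] of [x], the equality counts the neighbours of [y] at distance 1 and 2
    from [x], and gives exactly [t = 2 D / L - 2] ([triangles_antipodal]).  Now
    [2 / L <= kappa x y] is the inequality [(D + 1) W1 <= n] that produces the
    matching, so self-centered sharp graphs satisfy [Lambda (2D/L - 2)]. *)

(** * Graph distance *)

Section Distance.
Local Open Scope nat_scope.

Lemma bigmin_leq (I : eqType) (s : seq I) (P : pred I) (F : I -> nat) m i :
  i \in s -> P i -> \big[minn/m]_(j <- s | P j) F j <= F i.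
Proof.
elim: s => // j s IH; rewrite inE big_cons => /orP[/eqP <- Pi|is_ Pi].
  by rewrite Pi geq_minl.
by case: ifP => _; [exact: leq_trans (geq_minr _ _) (IH is_ Pi)|exact: IH].
Qed.

Lemma bigmin_le_default (I : Type) (s : seq I) (P : pred I) (F : I -> nat) m :
  \big[minn/m]_(j <- s | P j) F j <= m.
Proof. by elim/big_rec: _ => // i x _; apply: leq_trans; exact: geq_minr. Qed.

Lemma bigmin_attained (I : Type) (s : seq I) (P : pred I) (F : I -> nat) m :
  \big[minn/m]_(j <- s | P j) F j < m ->
  exists2 i, P i & \big[minn/m]_(j <- s | P j) F j = F i.
Proof.
elim/big_rec: _ => [|i x Pi IH]; first by rewrite ltnn.
case: (leqP (F i) x) => [Fix _|xF xm]; last exact: IH.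
by exists i.
Qed.

Variables (T : finType) (e : rel T).

Lemma dist_le_walk x p : path e x p -> dist e x (last x p) <= size p.
Proof.
move=> pp; case: (ltnP (size p) #|T|) => [lt_p|]; last first.
  exact/leq_trans/bigmin_le_default.
apply: (@bigmin_leq _ _ _ _ _ (Ordinal lt_p)); first exact: mem_index_enum.
by apply/existsP; exists (in_tuple p); rewrite pp eqxx.
Qed.

(** A loop-free walk has fewer than [#|T|] edges, so for connected points the
    minimum defining [dist] is not the default value. *)
Lemma dist_attained x y : connect e x y ->
  exists p, [/\ path e x p, last x p = y & size p = dist e x y].
Proof.
case/connectP=> p0 pp0 ->; case/shortenP: pp0 => p pp Up _.
have lt_p : size p < #|T| by rewrite -[(size p).+1](card_uniqP Up) max_card.
have [n] := bigmin_attained (leq_ltn_trans (dist_le_walk pp) lt_p).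
case/existsP=> q /andP[pq /eqP lq] def_n.
by exists q; split=> //; rewrite size_tuple -def_n.
Qed.

Lemma dist_xx x : dist e x x = 0.
Proof. by apply/eqP; rewrite -leqn0 (@dist_le_walk x [::]). Qed.

Hypothesis e_conn : connected_graph e.

Lemma dist_eq0 x y : (dist e x y == 0) = (x == y).
Proof.
apply/eqP/eqP => [d0|->]; last exact: dist_xx.
have [p [_ lp]] := dist_attained (e_conn x y).
by rewrite d0 => /size0nil p0; rewrite -lp p0.
Qed.

Lemma dist_step x y z : e y z -> dist e x z <= (dist e x y).+1.
Proof.
move=> eyz; have [p [pp lp <-]] := dist_attained (e_conn x y).
have -> : z = last x (rcons p z) by rewrite last_rcons.
by rewrite -(size_rcons p z) dist_le_walk // rcons_path pp lp.
Qed.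

Lemma dist_eq1 x y : irreflexive e -> (dist e x y == 1) = e x y.
Proof.
move=> irr; apply/eqP/idP => [d1|exy].
  have [p [pp lp]] := dist_attained (e_conn x y); move: pp lp; rewrite d1.
  by case: p => [|z [|? ?]] //=; rewrite andbT => exz <-.
apply/eqP; rewrite eqn_leq -{1}(dist_xx x) dist_step //= lt0n dist_eq0.
by apply: contraTneq exy => ->; rewrite irr.
Qed.

End Distance.

(** Serves twice: with [c = 1] it turns the Lipschitz condition on edges into the
    one for [dist], and with [c] a curvature term it integrates a gradient bound. *)
Lemma walk_growth (R : numDomainType) (T : finType) (e : rel T) (f : T -> R)
    (c : R) :
  (forall u v, e u v -> f v <= f u + c) ->
  forall x p, path e x p -> f (last x p) <= f x + (size p)%:R * c.
Proof.
move=> fc x p; elim: p x => [|y p IH] x /=; first by rewrite mul0r addr0.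
case/andP=> exy /IH /le_trans; apply.
by rewrite -natr1 mulrDl mul1r [_ * c + c]addrC addrA lerD2r fc.
Qed.

Lemma dist_growth (R : numDomainType) (T : finType) (e : rel T) (f : T -> R)
    (c : R) :
  connected_graph e -> (forall u v, e u v -> f v <= f u + c) ->
  forall x y, f y <= f x + (dist e x y)%:R * c.
Proof.
move=> e_conn fc x y.
have [p [pp lp <-]] := dist_attained (e_conn x y).
by rewrite -lp; exact: walk_growth fc _ _ pp.
Qed.

(** * Hall's marriage theorem *)

Section Hall.
Local Open Scope nat_scope.
Local Open Scope set_scope.
Variables (T U : finType) (A : {set T}).

Definition hall_condition (F : T -> {set U}) : bool :=
  [forall S : {set T}, (S \subset A) ==> (#|S| <= #|\bigcup_(a in S) F a|)].

(** Rado's step.  If deleting [b1] and deleting [b2] from [F a] both break Hall's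
    condition, there are sets [S1], [S2] avoiding [a] such that [a |: Si] has at
    most [#|Si|] neighbours after the deletion of [bi].  The union of these two
    neighbourhoods contains that of [a |: (S1 :|: S2)], as [b1 != b2], and their
    intersection contains that of [S1 :&: S2]; counting contradicts Hall's
    condition for these two sets. *)
Lemma hall_remove_one (F : T -> {set U}) a b1 b2 (F1 := fun b c =>
    if c == a then F c :\ b else F c) :
  hall_condition F -> a \in A -> b1 != b2 ->
  hall_condition (F1 b1) || hall_condition (F1 b2).
Proof.
move=> /forallP hF Aa b12; apply/negPn/negP; rewrite negb_or.
have critical b : ~~ hall_condition (F1 b) ->
    exists S : {set T}, [/\ S \subset A, a \notin S
       & #|(F a :\ b) :|: \bigcup_(c in S) F c| <= #|S|].
  case/forallPn=> S; rewrite negb_imply -ltnNge => /andP[SA ltS].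
  have aS : a \in S.
    apply: contraLR ltS => aS; rewrite -leqNgt.
    rewrite (eq_bigr F); first exact: (implyP (hF S)).
    by move=> c cS; rewrite /F1 ifN //; apply: contraNneq aS => <-; exact: cS.
  exists (S :\ a); split; rewrite ?setD11 //.
    exact: subset_trans (subD1set _ _) SA.
  rewrite [#|S|](cardsD1 a) aS add1n ltnS in ltS.
  apply: leq_trans ltS; rewrite (big_setD1 a aS) /= {1}/F1 eqxx.
  rewrite [X in _ <= #|_ :|: X|](eq_bigr F) // => c; rewrite !inE => /andP[ca _].
  by rewrite /F1 (negPf ca).
case/andP=> /critical[S1 [S1A aS1 le1]] /critical[S2 [S2A aS2 le2]].
have := leq_add le1 le2; rewrite -cardsUI -[#|S1| + _]cardsUI leqNgt.
case/negP; rewrite -addSn; apply: leq_add.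
  have := implyP (hF (a |: (S1 :|: S2))).
  rewrite !subUset sub1set Aa S1A S2A => /(_ isT).
  rewrite cardsU1 inE (negPf aS1) (negPf aS2) add1n => /leq_trans; apply.
  apply/subset_leq_card/bigcupsP => c; rewrite !inE.
  case/or3P => [/eqP-> | cS | cS]; apply/subsetP=> u uF; rewrite !inE.
  - by rewrite uF !andbT; case: eqP => //= ->; rewrite b12 /= orbT.
  - by have -> : u \in \bigcup_(c in S1) F c; [apply/bigcupP; exists c|rewrite orbT].
  - by have -> : u \in \bigcup_(c in S2) F c; [apply/bigcupP; exists c|rewrite !orbT].
have := implyP (hF (S1 :&: S2)); rewrite subIset ?S1A // => /(_ isT) /leq_trans.
apply; apply/subset_leq_card/bigcupsP => c; rewrite inE => /andP[c1 c2].
apply/subsetP=> u uF; rewrite !inE; apply/andP.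
by split; apply/orP; right; apply/bigcupP; exists c.
Qed.

(** Rado's proof: delete elements from the sets [F a] while Hall's condition
    survives.  When every [F a] has a single element, the condition for pairs
    is injectivity. *)
Theorem hall (u0 : U) (F : T -> {set U}) : hall_condition F ->
  exists2 g : T -> U, {in A, forall a, g a \in F a} & {in A &, injective g}.
Proof.
have [n] := ubnP (\sum_(a in A) #|F a|); elim: n F => // n IH F le_n hF.
case: (boolP [exists a in A, 1 < #|F a|]) => [|/exists_inPn small].
  case/exists_inP=> a Aa /card_gt1P[b1 [b2 [b1F b2F b12]]].
  have shrink b : b \in F a ->
      \sum_(c in A) #|if c == a then F c :\ b else F c| < n.
    move=> bF; rewrite ltnS in le_n; apply: leq_trans le_n.
    rewrite (bigD1 a) //= [leqRHS](bigD1 a) //= eqxx -addSn.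
    rewrite [#|F a|](cardsD1 b) bF add1n leq_add2l leq_sum // => c.
    by case/andP=> _ /negPf->.
  have restrict b : b \in F a ->
      hall_condition (fun c => if c == a then F c :\ b else F c) ->
      exists2 g : T -> U, {in A, forall a, g a \in F a} & {in A &, injective g}.
    move=> bF /IH[|g gF g_inj]; [exact: shrink | exists g => // c /gF].
    by case: eqP => // _; rewrite inE => /andP[].
  by case/orP: (hall_remove_one hF Aa b12); exact: restrict.
pose g a := odflt u0 [pick u in F a].
have gF : {in A, forall a, g a \in F a}.
  move=> a Aa; rewrite /g; case: pickP => //= F0.
  have := implyP (forallP hF [set a]).
  by rewrite sub1set Aa big_set1 cards1 => /(_ isT); rewrite eq_card0.
have Fg a : a \in A -> F a = [set g a].
  move=> Aa; apply/eqP; rewrite eq_sym eqEcard sub1set gF // cards1.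
  by rewrite leqNgt small.
exists g => // a a' Aa Aa' gaa'; apply/eqP/negPn/negP => aa'.
have := implyP (forallP hF [set a; a']).
rewrite subUset !sub1set Aa Aa' cards2 aa' => /(_ isT).
by rewrite big_setU1 ?big_set1 ?inE //= !Fg // gaa' setUid cards1.
Qed.
End Hall.

(** * Wasserstein distance of the measures mu *)

Section Transport.
Local Open Scope set_scope.
Variables (R : realType) (T : finType) (e : rel T).

Lemma cost_lbound (m n : T -> R) :
  lbound [set c : R | exists2 p : T -> T -> R, coupling m n p &
            c = \sum_(u : T) \sum_(v : T) (dist e u v)%:R * p u v]%classic 0.
Proof.
move=> _ [p [p01 _ _] ->]; apply: sumr_ge0 => u _; apply: sumr_ge0 => v _.
by apply: mulr_ge0 => //; case/andP: (p01 u v).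
Qed.

Lemma W1_le_cost (m n : T -> R) p : coupling m n p ->
  W1 e m n <= \sum_(u : T) \sum_(v : T) (dist e u v)%:R * p u v.
Proof.
by move=> mnp; apply: ge_inf; [exists 0; exact: cost_lbound | exists p].
Qed.

(** The easy half of Kantorovich duality. *)
Lemma W1_ge_test (m n f : T -> R) :
  (exists p, coupling m n p) -> (forall u v, f u <= f v + (dist e u v)%:R) ->
  \sum_u f u * m u - \sum_v f v * n v <= W1 e m n.
Proof.
move=> [p0 mnp0] f_lip; apply: lb_le_inf.
  by exists (\sum_u \sum_v (dist e u v)%:R * p0 u v), p0.
move=> _ [p [p01 pm pn] ->].
have -> : \sum_u f u * m u = \sum_u \sum_v f u * p u v.
  by apply: eq_bigr => u _; rewrite -pm mulr_sumr.
have -> : \sum_v f v * n v = \sum_u \sum_v f v * p u v.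
  by rewrite exchange_big; apply: eq_bigr => v _; rewrite -pn mulr_sumr.
rewrite -sumrB; apply: ler_sum => u _; rewrite -sumrB; apply: ler_sum => v _.
rewrite -mulrBl; apply: ler_wpM2r; first by case/andP: (p01 u v).
by rewrite lerBlDl f_lip.
Qed.

Definition ball (x : T) : {set T} := x |: nbhd e x.

Lemma in_ball x y : (y \in ball x) = (y == x) || e x y.
Proof. by rewrite !inE. Qed.

Variable D : nat.
Hypotheses (e_simple : simple_graph e) (e_regular : regular e D).

Lemma big_ball (V : zmodType) (f : T -> V) x :
  \sum_(z in ball x) f z = f x + \sum_(z | e x z) f z.
Proof.
rewrite big_setU1 ?inE ?e_simple.2 //; congr (_ + _).
by apply: eq_bigl => z; rewrite inE.
Qed.

Lemma card_ball x : #|ball x| = D.+1.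
Proof. by rewrite cardsU1 e_regular inE e_simple.2. Qed.

Lemma sum_mu (f : T -> R) x :
  \sum_z f z * mu R e D x z = D.+1%:R^-1 * \sum_(z in ball x) f z.
Proof.
rewrite mulr_sumr [RHS]big_mkcond; apply: eq_bigr => z _.
by rewrite /mu in_ball; case: ifP; rewrite ?mulr0 // mulrC.
Qed.

Lemma mu_total x : \sum_z mu R e D x z = 1.
Proof.
transitivity (\sum_z 1 * mu R e D x z); first by under [RHS]eq_bigr do rewrite mul1r.
by rewrite sum_mu sumr_const card_ball mulVf // pnatr_eq0.
Qed.

Lemma mu_ge0 x z : 0 <= mu R e D x z.
Proof. by rewrite /mu; case: ifP; rewrite ?invr_ge0 ?ler0n. Qed.

Lemma mu_le1 x z : mu R e D x z <= 1.
Proof. by rewrite /mu; case: ifP; rewrite ?ler01 // invf_le1 ?ltr0n ?ler1n. Qed.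

Lemma coupling_mu x y : exists p, coupling (mu R e D x) (mu R e D y) p.
Proof.
exists (fun u v => mu R e D x u * mu R e D y v); split=> [u v|u|v].
- by rewrite mulr_ge0 ?mulr_ile1 ?mu_ge0 ?mu_le1.
- by rewrite -mulr_sumr mu_total mulr1.
- by rewrite -mulr_suml mu_total mul1r.
Qed.

Lemma W1_mu_ge (f : T -> R) x y :
  connected_graph e -> (forall u v, e u v -> f v <= f u + 1) ->
  \sum_(z in ball x) f z - \sum_(z in ball y) f z
    <= D.+1%:R * W1 e (mu R e D x) (mu R e D y).
Proof.
move=> e_conn f1; rewrite -ler_pdivrMl ?ltr0n // mulrBr -!sum_mu.
apply: W1_ge_test; first exact: coupling_mu.
move=> u v; have := dist_growth e_conn (f := fun z => - f z) (c := 1).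
move=> /(_ _ u v); rewrite mulr1 => fl; have : - f v <= - f u + (dist e u v)%:R.
  by apply: fl => a b eab; have := f1 b a; rewrite e_simple.1 => /(_ eab); lra.
lra.
Qed.

(** Transport along the graph of [h]; as the balls have the same size, [h] is a
    bijection between them. *)
Lemma W1_mu_le x y (h : T -> T) :
  {in ball x, forall u, h u \in ball y} -> {in ball x &, injective h} ->
  D.+1%:R * W1 e (mu R e D x) (mu R e D y)
    <= \sum_(u in ball x) (dist e u (h u))%:R.
Proof.
move=> h_ball h_inj; rewrite -ler_pdivlMl ?ltr0n //.
have h_im : h @: ball x = ball y.
  apply/eqP; rewrite eqEcard card_in_imset // !card_ball leqnn andbT.
  by apply/subsetP=> _ /imsetP[u ux ->]; exact: h_ball.
pose p u v : R := if (u \in ball x) && (v == h u) then D.+1%:R^-1 else 0.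
have mnp : coupling (mu R e D x) (mu R e D y) p.
  split=> [u v|u|v]; rewrite /p.
  - by case: ifP => _; rewrite ?lexx ?ler01 // invr_ge0 ler0n invf_le1 ?ltr0n ?ler1n.
  - rewrite /mu -in_ball -big_mkcond; case: ifP => ux; rewrite ?big_pred0_eq //.
    by rewrite big_pred1_eq.
  - rewrite /mu -in_ball -h_im -big_mkcond /=; case: ifP => [/imsetP[w wx ->]|].
      rewrite (big_pred1 w) // => u; apply/andP/eqP => [[ux /eqP huw]|->//].
      exact: h_inj.
    move/negP=> vh; rewrite big_pred0 // => u; apply/negP=> /andP[ux /eqP vhu].
    by apply: vh; rewrite vhu imset_f.
apply: le_trans (W1_le_cost mnp) _.
rewrite mulr_sumr [leRHS]big_mkcond; apply: ler_sum => u _.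
rewrite (bigD1 (h u)) //= big1 => [|v /negPf vhu]; last by rewrite /p vhu andbF mulr0.
by rewrite /p eqxx andbT addr0; case: ifP; rewrite ?mulr0 // mulrC.
Qed.

End Transport.

(** * Triangles, matchings and transport along an edge *)

Section Edges.
Local Open Scope set_scope.
Variables (T : finType) (e : rel T) (D : nat).
Hypotheses (e_simple : simple_graph e) (e_regular : regular e D).

Lemma common_nbhdC x y : common_nbhd e x y = common_nbhd e y x.
Proof. exact: setIC. Qed.

Lemma card_triangles x y : e x y -> #|triangles e x y| = #|common_nbhd e x y|.
Proof.
case: e_simple => e_sym e_irr exy.
have neq u v : e u v -> u != v by apply: contraTneq => ->; rewrite e_irr.
rewrite -(@card_in_imset _ _ (fun z => [set x; y; z])); last first.
  move=> z w; rewrite !inE => /andP[exz eyz] _ /setP/(_ z).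
  rewrite !inE eqxx !orbT eq_sym (negPf (neq _ _ exz)).
  by rewrite eq_sym (negPf (neq _ _ eyz)) => /esym/eqP.
congr #|pred_of_set _|; apply/setP=> t; rewrite inE.
apply/and4P/imsetP => [[/eqP t3 tx ty /forall_inP clique]|[z]].
  have adj u v : u \in t -> v \in t -> u != v -> e u v.
    by move=> ut vt; move/forall_inP: (clique u ut) => /(_ v vt)/implyP.
  have : #|t :\ x :\ y| = 1%N.
    have := t3; rewrite (cardsD1 x) tx (cardsD1 y) !inE ty eq_sym neq //.
    by rewrite !add1n => -[].
  case/eqP/cards1P=> z tz; have : z \in t :\ x :\ y by rewrite tz set11.
  rewrite !inE => /and3P[zy zx zt]; exists z.
    by rewrite !inE; apply/andP; split; apply: adj; rewrite // eq_sym.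
  apply/eqP; rewrite eq_sym eqEcard t3; apply/andP; split.
    by rewrite !subUset !sub1set tx ty zt.
  by rewrite setUC cardsU1 cards2 !inE negb_or zy zx neq.
rewrite !inE => /andP[exz eyz] ->; split; rewrite ?inE ?eqxx ?orbT //.
  rewrite setUC cardsU1 cards2 !inE negb_or (neq _ _ exy).
  by rewrite ![z == _]eq_sym !neq.
apply/forall_inP=> u; rewrite !inE -orbA => ut; apply/forall_inP=> v.
rewrite !inE -orbA => vt; apply/implyP.
by case/or3P: ut => /eqP->; case/or3P: vt => /eqP->; rewrite ?eqxx // e_sym.
Qed.

Definition private_nbhd (x y : T) : {set T} :=
  nbhd e x :\: (common_nbhd e x y :|: [set y]).

Lemma in_private_nbhd x y z :
  (z \in private_nbhd x y) = [&& e x z, ~~ e y z & z != y].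
Proof. by rewrite !inE; case: (e x z); rewrite ?andbF // negb_or /= andbT. Qed.

Lemma big_ball_edge (V : zmodType) (f : T -> V) x y : e x y ->
  \sum_(z in ball e x) f z =
  f x + f y + \sum_(z in common_nbhd e x y) f z
            + \sum_(z in private_nbhd x y) f z.
Proof.
case: e_simple => e_sym e_irr exy.
rewrite big_setU1 ?inE ?e_irr // -!addrA; congr (_ + _).
rewrite (big_setID (common_nbhd e x y :|: [set y])) /= addrA; congr (_ + _).
rewrite (setIidPr _); last by rewrite subUset subsetIl sub1set inE.
by rewrite setUC big_setU1 // !inE e_irr andbF.
Qed.

Lemma card_private_nbhd x y : e x y ->
  D = (#|triangles e x y| + #|private_nbhd x y|).+1.
Proof.
move=> exy; rewrite card_triangles // -(e_regular x).
rewrite -(cardsID (common_nbhd e x y :|: [set y])) -addSn; congr (_ + _)%N.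
rewrite (setIidPr _); last by rewrite subUset subsetIl sub1set inE.
by rewrite setUC cardsU1 !inE e_simple.2 andbF.
Qed.

Lemma card_private_nbhdC x y : e x y ->
  #|private_nbhd x y| = #|private_nbhd y x|.
Proof.
move=> exy; have eyx : e y x by rewrite e_simple.1.
have := card_private_nbhd exy; rewrite {1}(card_private_nbhd eyx).
by rewrite !card_triangles // common_nbhdC => -[/addnI].
Qed.

Definition matching_map x y (g : T -> T) : Prop :=
  {in private_nbhd x y, forall a, g a \in private_nbhd y x /\ e a (g a)} /\
  {in private_nbhd x y &, injective g}.

(** Two disjoint sets of the same size: an injection along edges and the set of
    its edges determine each other. *)
Lemma perfect_matchingP x y : e x y ->
  (exists M, perfect_matching e
      (nbhd e x :\: (common_nbhd e x y :|: [set y]%SET))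
      (nbhd e y :\: (common_nbhd e x y :|: [set x]%SET)) M) <->
  exists g, matching_map x y g.
Proof.
move=> exy; rewrite {2}common_nbhdC -/(private_nbhd x y) -/(private_nbhd y x).
have AB a : a \in private_nbhd x y -> a \in private_nbhd y x -> False.
  by rewrite !in_private_nbhd => /and3P[-> _ _] /and3P[].
split=> [[M [M_edge M_disj M_cover]]|[g [g_edge g_inj]]].
  have partner a : a \in private_nbhd x y ->
      exists2 v, v \in private_nbhd y x & e a v && ([set a; v] \in M).
    move=> aA; have : a \in finset.cover M by rewrite M_cover inE aA.
    case/finset.bigcupP=> E EM; have [u [v [uA vB euv defE]]] := M_edge E EM.
    rewrite defE !inE => /orP[/eqP au|/eqP av]; last by case: (AB a aA); rewrite av.
    by exists v; rewrite // au euv -defE.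
  pose g a := odflt x [pick v in private_nbhd y x | e a v && ([set a; v] \in M)].
  have gP a : a \in private_nbhd x y ->
      [/\ g a \in private_nbhd y x, e a (g a) & [set a; g a] \in M].
    move=> aA; rewrite /g; case: pickP => [v /and3P[] //|no].
    by have [v vB vM] := partner a aA; have := no v; rewrite vB vM.
  exists g; split=> [a /gP[]//|a b aA bA gab].
  have [gaB _ aM] := gP a aA; have [_ _ bM] := gP b bA.
  have [|neq] := eqVneq [set a; g a] [set b; g b].
    move/setP/(_ a); rewrite !inE eqxx -gab => /esym/orP[/eqP//|/eqP aga].
    by case: (AB a aA); rewrite aga.
  have /finset.trivIsetP/(_ _ _ aM bM neq) := M_disj.
  by move/pred0P/(_ (g a)); rewrite /= !inE gab eqxx !orbT.
have g_im : g @: private_nbhd x y = private_nbhd y x.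
  apply/eqP; rewrite eqEcard card_in_imset // (card_private_nbhdC exy) leqnn.
  by rewrite andbT; apply/subsetP=> _ /imsetP[a aA ->]; case: (g_edge a aA).
exists [set [set a; g a] | a in private_nbhd x y]; split.
- move=> _ /imsetP[a aA ->]; exists a, (g a).
  by case: (g_edge a aA).
- apply/finset.trivIsetP=> _ _ /imsetP[a aA ->] /imsetP[b bA ->] neq.
  have ab : a != b by apply: contraNneq neq => ->.
  apply/pred0P=> z /=; apply/negP; rewrite !inE => /andP[].
  have [gaB _] := g_edge a aA; have [gbB _] := g_edge b bA.
  case/orP=> /eqP-> /orP[] => [|/eqP ag|/eqP gb|/eqP gg].
  + by apply/negP.
  + by apply: (AB a aA); rewrite ag.
  + by apply: (AB b bA); rewrite -gb.
  + by move/eqP: ab; apply; exact: g_inj.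
- rewrite finset.cover_imset; apply/setP=> z; rewrite inE.
  apply/finset.bigcupP/orP => [[a aA]|[zA|]].
  + rewrite in_set2 => /orP[/eqP->|/eqP->]; [by left | right].
    by case: (g_edge a aA).
  + by exists z; rewrite // in_set2 eqxx.
  + by rewrite -g_im => /imsetP[a aA ->]; exists a; rewrite // in_set2 eqxx orbT.
Qed.

Hypothesis e_conn : connected_graph e.
Variable R : realType.

(** Leave the common part of the two balls in place and move each private
    neighbour of [x] along its matching edge. *)
Lemma W1_matching x y g : e x y -> matching_map x y g ->
  D.+1%:R * W1 e (mu R e D x) (mu R e D y) <= #|private_nbhd x y|%:R.
Proof.
case: (e_simple) => e_sym e_irr exy [g_edge g_inj].
pose h u := if u \in private_nbhd x y then g u else u.
have in_ball_x u : u \in ball e x ->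
    (u \in private_nbhd x y) || (u \in ball e y).
  rewrite in_private_nbhd !in_ball => /predU1P[->|->] /=.
    by rewrite e_sym exy !orbT.
  by case: (e y u); rewrite ?orbT //; case: eqP.
have not_ball_y u : u \in private_nbhd y x -> u \notin ball e x.
  by rewrite in_private_nbhd in_ball => /and3P[_ /negPf-> /negPf->].
have h_ball : {in ball e x, forall u, h u \in ball e y}.
  move=> u /in_ball_x; rewrite /h; case: ifP => //= uA _.
  have [+ _] := g_edge u uA.
  by rewrite in_private_nbhd in_ball => /and3P[-> _ _]; rewrite orbT.
have h_inj : {in ball e x &, injective h}.
  move=> u v ux vx; rewrite /h; case: ifP => uA; case: ifP => vA //.
  - exact: g_inj.
  - by move=> guv; have [/not_ball_y] := g_edge u uA; rewrite guv vx.
  - by move=> ugv; have [/not_ball_y] := g_edge v vA; rewrite -ugv ux.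
apply: (le_trans (W1_mu_le R e_simple e_regular h_ball h_inj)).
rewrite -natr_sum ler_nat (bigID [in private_nbhd x y]) /=.
rewrite [X in (_ + X)%N]big1 => [|u /andP[_ /negPf uA]]; last first.
  by rewrite /h uA dist_xx.
rewrite addn0 -sum1_card (eq_bigl [in private_nbhd x y]); last first.
  move=> u /=; rewrite in_private_nbhd in_ball andbC.
  by case: (e x u); rewrite ?orbT ?andbT // andbF.
apply: leq_sum => u uA; rewrite /h uA; have [_ eug] := g_edge u uA.
by have/eqP-> : dist e u (g u) == 1%N by rewrite dist_eq1.
Qed.

(** If [S] violates Hall's condition, let [far] be the set of private neighbours
    of [y] adjacent to no vertex of [S].  The function that is 1 on [S], -1 on
    [far] and 0 elsewhere is 1-Lipschitz because no edge joins [S] to [far], and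
    its ball sums differ by [#|S| + #|far|], which exceeds the number of private
    neighbours. *)
Lemma matching_of_W1 x y : e x y ->
  D.+1%:R * W1 e (mu R e D x) (mu R e D y) <= #|private_nbhd x y|%:R ->
  exists g, matching_map x y g.
Proof.
move=> exy W1_le.
pose N a := [set b in private_nbhd y x | e a b].
suff /(hall x)[g gN g_inj] : hall_condition (private_nbhd x y) N.
  by exists g; split=> // a /gN; rewrite inE => /andP[].
apply/forallP=> S; apply/implyP=> SA; set NS := \bigcup_(a in S) N a.
pose far := private_nbhd y x :\: NS.
have NSB : NS \subset private_nbhd y x.
  by apply/finset.bigcupsP=> a _; apply/subsetP=> b; rewrite inE => /andP[].
have S_far u v : u \in S -> v \in far -> ~~ e u v.
  move=> uS; rewrite inE => /andP[vNS vB]; apply: contraNN vNS => euv.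
  by apply/finset.bigcupP; exists u; rewrite // inE vB.
pose f z : R := (z \in S)%:R - (z \in far)%:R.
have disj z : z \in private_nbhd x y -> z \in private_nbhd y x = false.
  by rewrite !in_private_nbhd => /and3P[-> _ _]; rewrite /= andbF.
have f_lip u v : e u v -> f v <= f u + 1.
  move=> euv; rewrite /f.
  have := S_far v u; rewrite e_simple.1 euv.
  case: (v \in S) => /=; first case: (u \in far) => /=; first by move=> /(_ isT isT).
    by move=> _; case: (u \in S); case: (v \in far) => /=; lra.
  by move=> _; case: (u \in far); case: (u \in S); case: (v \in far) => /=; lra.
have := W1_mu_ge e_simple e_regular x y e_conn f_lip.
move=> /le_trans /(_ W1_le).
have eyx : e y x by rewrite e_simple.1.
rewrite (big_ball_edge f exy) (big_ball_edge f eyx) (common_nbhdC y x).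
have -> : \sum_(z in private_nbhd x y) f z = #|S|%:R.
  rewrite -sum1_card natr_sum (big_setID S) /= (setIidPr SA).
  rewrite [X in _ + X]big1 ?addr0 => [|z]; last first.
    rewrite inE => /andP[/negPf zS zA].
    by rewrite /f zS inE (disj z zA) andbF subrr.
  apply: eq_bigr => z zS.
  by rewrite /f zS inE (disj z (subsetP SA z zS)) andbF subr0.
have -> : \sum_(z in private_nbhd y x) f z = - #|far|%:R.
  rewrite -sum1_card natr_sum (big_setID far) /= (setIidPr (subsetDl _ _)).
  have zS z : z \in private_nbhd y x -> z \in S = false.
    move=> zB; apply/negP=> /(subsetP SA) /disj; by rewrite zB.
  rewrite [X in _ + X]big1 ?addr0 => [|z]; last first.
    by rewrite inE => /andP[/negPf zF /zS zS']; rewrite /f zF zS' subrr.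
  rewrite -sumrN; apply: eq_bigr => z zF.
  by rewrite /f zF zS ?sub0r //; move: zF; rewrite inE => /andP[].
rewrite cardsD (setIidPr NSB) (card_private_nbhdC exy).
rewrite (natrB _ (subset_leq_card NSB)) -(ler_nat R); lra.
Qed.

End Edges.

(** * Comparison with curvature bounded below *)

Section Rigidity.
Variables (R : realType) (T : finType) (e : rel T) (D : nat).
Hypotheses (e_simple : simple_graph e) (e_regular : regular e D).
Hypothesis e_conn : connected_graph e.

Lemma degree_gt0 x y : e x y -> (0 < D)%N.
Proof. by move=> /(card_private_nbhd e_simple e_regular)->. Qed.

Lemma dist_sym x y : dist e x y = dist e y x.
Proof.
wlog suff: x y / (dist e x y <= dist e y x)%N.
  by move=> le; apply/eqP; rewrite eqn_leq !le.
rewrite -(ler_nat R); have := dist_growth (R := R) (c := 1) e_conn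
  (f := fun z => (dist e z y)%:R) _ y x.
rewrite mulr1 dist_xx add0r; apply=> u v euv.
have [p [pp lp sp]] := dist_attained (e_conn u y).
rewrite natr1 ler_nat -sp -lp.
by apply: (@dist_le_walk _ _ v (u :: p)); rewrite /= e_simple.1 euv.
Qed.

Lemma le_kappa_edge K x y : e x y ->
  (K <= kappa R e D x y) =
  (D.+1%:R * W1 e (mu R e D x) (mu R e D y) <= D.+1%:R - K * D%:R).
Proof.
move=> exy; have D0 : 0 < D%:R :> R by rewrite ltr0n (degree_gt0 exy).
have /eqP d1 : dist e x y == 1%N by rewrite (dist_eq1 e_conn _ _ e_simple.2).
rewrite /kappa d1 divr1 mulrAC ler_pdivlMr // mulrBr mulr1.
by rewrite lerBrDr lerBrDl addrC.
Qed.

(** The infimum ranges over finitely many values, hence over a set bounded below;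
    otherwise [inf] would carry no information. *)
Lemma inf_kappa_le x y : e x y ->
  inf [set k : R | exists x y : T, e x y /\ k = kappa R e D x y]%classic
    <= kappa R e D x y.
Proof.
move=> exy; apply: ge_inf; last by exists x, y.
exists (- \sum_u \sum_v `|kappa R e D u v|) => _ [u [v [_ ->]]].
rewrite lerNl (bigD1 u) //= (bigD1 v) //= -!addrA.
apply: ler_wpDr; last by rewrite -normrN ler_norm.
by rewrite addr_ge0 ?sumr_ge0 // => i _; rewrite sumr_ge0.
Qed.

Lemma sum_balls (V : zmodType) (f : T -> V) :
  \sum_x \sum_(z in ball e x) f z = (\sum_x f x) *+ D.+1.
Proof.
rewrite (exchange_big_dep predT) //= -sumrMnl; apply: eq_bigr => z _.
rewrite -(card_ball e_simple e_regular z) -sumr_const; apply: eq_bigl => x.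
by rewrite !in_ball eq_sym e_simple.1.
Qed.

Variable K : R.
Hypothesis K_le : forall x y, e x y -> K <= kappa R e D x y.

(** Laplacian comparison: along an edge the ball sum of a 1-Lipschitz function
    grows by at most [(D + 1) W1], which the curvature bounds; this accumulates
    along a shortest walk from [x0]. *)
Lemma sum_ball_dist x0 x :
  \sum_(z in ball e x0) (dist e x0 z)%:R = D%:R :> R /\
  \sum_(z in ball e x) (dist e x0 z)%:R
    <= D%:R + (dist e x0 x)%:R * (D.+1%:R - K * D%:R).
Proof.
have at_x0 : \sum_(z in ball e x0) (dist e x0 z)%:R = D%:R :> R.
  rewrite (big_ball e_simple) dist_xx add0r -(e_regular x0) -sum1_card natr_sum.
  apply: eq_big => [z|z exz]; first by rewrite inE.
  by have /eqP-> : dist e x0 z == 1%N by rewrite (dist_eq1 e_conn _ _ e_simple.2).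
split=> //; have := dist_growth (R := R) (c := D.+1%:R - K * D%:R) e_conn
  (f := fun y => \sum_(z in ball e y) (dist e x0 z)%:R) _ x0 x.
rewrite at_x0; apply=> u v euv.
have evu : e v u by rewrite e_simple.1.
rewrite -lerBlDl; apply: (@le_trans _ _ (D.+1%:R * W1 e (mu R e D v) (mu R e D u))).
  apply: W1_mu_ge => // a b eab; rewrite natr1 ler_nat.
  exact: dist_step.
by rewrite -le_kappa_edge // K_le.
Qed.

(** The ball sum at [y] of the distance from [x] is at least [d + D (d - 1)],
    as neighbours of [y] are at distance at least [d - 1] from [x]. *)
Lemma bonnet_myers x y : (0 < dist e x y)%N ->
  K * D%:R * (dist e x y)%:R <= 2 * D%:R.
Proof.
move=> d0; have [_] := sum_ball_dist x y; set d := dist e x y in d0 *.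
have : d%:R + D%:R * (d%:R - 1) <= \sum_(z in ball e y) (dist e x z)%:R :> R.
  rewrite (big_ball e_simple) lerD2l -(e_regular y) mulr_natl -sumr_const.
  rewrite (eq_bigl (e y)) => [|z]; last by rewrite inE.
  apply: ler_sum => z eyz; rewrite lerBlDr natr1 ler_nat dist_step //.
  by rewrite e_simple.1.
rewrite -[D.+1%:R]natr1; lra.
Qed.

(** Adding the comparisons for both poles bounds [h], a nonnegative multiple of
    the excess [g - L], by [defect], which is minus the graph Laplacian of [g].
    The defect has total 0 on a regular graph, so it vanishes and no slack
    remains in either comparison. *)
Lemma antipodal_equality x x' y :
  K * (dist e x x')%:R = 2 -> 0 < K -> (0 < D)%N ->
  \sum_(z in ball e y) (dist e x z)%:R
    = D%:R + (dist e x y)%:R * (D.+1%:R - K * D%:R).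
Proof.
move=> KL K0 D0; pose g z : R := (dist e x z)%:R + (dist e x' z)%:R.
have D0R : 0 < D%:R :> R by rewrite ltr0n.
have g_ge z : (dist e x x')%:R <= g z.
  rewrite /g [dist e x' z]dist_sym.
  have := dist_growth (R := R) (c := 1) e_conn
    (f := fun w => (dist e x w)%:R) _ z x'.
  rewrite mulr1; apply=> u v euv; rewrite natr1 ler_nat.
  exact: dist_step.
pose h z := K * D%:R * (g z - (dist e x x')%:R).
have h_ge0 z : 0 <= h z by rewrite /h !mulr_ge0 ?subr_ge0 ?g_ge // ltW.
pose defect z := D.+1%:R * g z - \sum_(w in ball e z) g w.
have h_le z : h z <= defect z.
  rewrite /defect big_split /=; have [_ le1] := sum_ball_dist x z.
  have [_ le2] := sum_ball_dist x' z.
  have KDL : K * D%:R * (dist e x x')%:R = 2 * D%:R by rewrite mulrAC KL.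
  have -> : h z = K * D%:R * g z - 2 * D%:R by rewrite /h mulrBr KDL.
  by move: le1 le2; rewrite /g -[D.+1%:R]natr1; lra.
have defect0 : defect y = 0.
  apply: (psumr_eq0P (P := predT) (F := defect)) => // [z _|].
    exact: le_trans (h_le z).
  by rewrite sumrB -mulr_sumr sum_balls mulr_natl subrr.
have gy : g y = (dist e x x')%:R.
  have /eqP : h y = 0 by apply/le_anti; rewrite h_ge0 -defect0 h_le.
  by rewrite /h !mulf_eq0 (gt_eqF K0) (gt_eqF D0R) subr_eq0 => /eqP.
apply/le_anti; rewrite (sum_ball_dist x y).2 /=.
have [_ le2] := sum_ball_dist x' y; move: le2 defect0.
have KDg : K * D%:R * g y = 2 * D%:R by rewrite gy mulrAC KL.
by move: KDg; rewrite /defect big_split /= /g -[D.+1%:R]natr1; lra.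
Qed.

(** Around a neighbour [y] of [x] the distance from [x] is 0 at [x], 1 at [y] and
    on the [t] common neighbours, and 2 on the [D - 1 - t] private neighbours of
    [y], so its ball sum is [2 D - 1 - t]; equality in the comparison fixes [t]. *)
Lemma triangles_antipodal x x' y :
  K * (dist e x x')%:R = 2 -> 0 < K -> e x y ->
  #|triangles e x y|%:R = K * D%:R - 2 :> R.
Proof.
move=> KL K0 exy; have eyx : e y x by rewrite e_simple.1.
have := antipodal_equality y KL K0 (degree_gt0 exy).
rewrite (big_ball_edge e_simple _ eyx) dist_xx.
have d1 z : e x z -> dist e x z = 1%N.
  by move=> exz; apply/eqP; rewrite (dist_eq1 e_conn _ _ e_simple.2).
rewrite d1 // common_nbhdC.
rewrite (eq_bigr (fun=> 1)) => [|z]; last by rewrite !inE => /andP[/d1->].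
rewrite [X in _ + _ + _ + X](eq_bigr (fun=> 2)) => [|z]; last first.
  rewrite in_private_nbhd => /and3P[eyz nexz nzx]; congr _%:R.
  apply/eqP; rewrite eqn_leq -{1}(d1 y exy) dist_step //= ltn_neqAle lt0n.
  by rewrite eq_sym (dist_eq1 e_conn _ _ e_simple.2) nexz dist_eq0 // eq_sym.
rewrite !sumr_const -(card_private_nbhdC e_simple e_regular exy).
rewrite -(card_triangles e_simple exy).
have : D%:R = #|triangles e x y|%:R + #|private_nbhd e x y|%:R + 1 :> R.
  by rewrite -natrD natr1 -(card_private_nbhd e_simple e_regular exy).
rewrite -[D.+1%:R]natr1 -[2%:R *+ _]mulr_natl; lra.
Qed.
End Rigidity.

(** * The equivalence *)

Unset Implicit Arguments.

Theorem proposition1p12 (R : realType) (T : finType) (e : rel T) (D L : nat)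
    (e_simple : simple_graph e) (e_connected : connected_graph e)
    (e_edge : has_edge e) (e_regular : regular e D) (e_diam : diam e = L) :
  ((self_centered e /\ Bonnet_Myers_sharp R e D) <->
   (self_centered e /\ Lambda e (2 * D%:R / L%:R - 2 : R))) /\
  ((self_centered e /\ Bonnet_Myers_sharp R e D) \/
   (self_centered e /\ Lambda e (2 * D%:R / L%:R - 2 : R)) ->
   forall x y : T, e x y -> #|triangles e x y|%:R = 2 * D%:R / L%:R - 2 :> R).
Proof.
have [a [b eab]] := e_edge.
have D0 : 0 < D%:R :> R by rewrite ltr0n (degree_gt0 e_simple e_regular eab).
have L_gt0 : (0 < L)%N.
  rewrite -e_diam; apply: leq_trans (leq_bigmax a); apply: leq_trans (leq_bigmax b).
  have /eqP-> // : dist e a b == 1%N by rewrite (dist_eq1 _ _ _ e_simple.2).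
have L0 : 0 < L%:R :> R by rewrite ltr0n.
have K0 : 0 < 2 / L%:R :> R by rewrite divr_gt0.
have D_card x y : e x y ->
    D%:R = #|triangles e x y|%:R + #|private_nbhd e x y|%:R + 1 :> R.
  by move=> exy; rewrite -natrD natr1 -(card_private_nbhd e_simple e_regular exy).
have curved_triangles : self_centered e ->
    (forall x y, e x y -> 2 / L%:R <= kappa R e D x y) ->
    forall x y, e x y -> #|triangles e x y|%:R = 2 * D%:R / L%:R - 2 :> R.
  move=> centered K_le x y exy; have [x' dx'] := centered x.
  rewrite mulrAC.
  apply: (triangles_antipodal e_simple e_regular e_connected K_le _ K0 exy (x' := x')).
  by rewrite dx' e_diam divfK // gt_eqF.
have sharp_curved : Bonnet_Myers_sharp R e D ->
    forall x y, e x y -> 2 / L%:R <= kappa R e D x y.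
  by rewrite /Bonnet_Myers_sharp e_diam => <- x y; exact: inf_kappa_le.
have Lambda_curved : Lambda e (2 * D%:R / L%:R - 2 : R) ->
    forall x y, e x y -> 2 / L%:R <= kappa R e D x y.
  move=> lam x y exy; have [t_ge M] := lam x y exy.
  have [g gP] := (perfect_matchingP e_simple e_regular exy).1 M.
  have := W1_matching e_simple e_regular e_connected R exy gP.
  rewrite (le_kappa_edge e_simple e_regular e_connected _ exy).
  move=> /le_trans; apply; rewrite -[D.+1%:R]natr1.
  by have := D_card x y exy; rewrite mulrAC in t_ge; lra.
have sharp_Lambda : self_centered e -> Bonnet_Myers_sharp R e D ->
    Lambda e (2 * D%:R / L%:R - 2 : R).
  move=> centered sharp x y exy.
  have t_eq := curved_triangles centered (sharp_curved sharp) x y exy.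
  split; first by rewrite t_eq.
  apply/(perfect_matchingP e_simple e_regular exy).
  apply: (matching_of_W1 e_simple e_regular e_connected (R := R)) => //.
  have := sharp_curved sharp x y exy.
  rewrite (le_kappa_edge e_simple e_regular e_connected _ exy).
  move=> /le_trans; apply; rewrite -[D.+1%:R]natr1.
  by have := D_card x y exy; rewrite mulrAC in t_eq; lra.
have Lambda_sharp : self_centered e -> Lambda e (2 * D%:R / L%:R - 2 : R) ->
    Bonnet_Myers_sharp R e D.
  move=> centered lam; rewrite /Bonnet_Myers_sharp e_diam; apply/le_anti/andP; split.
    (* Bonnet-Myers for K the infimum itself, between a point and its antipode *)
    have [a' da'] := centered a; rewrite e_diam in da'.
    have := bonnet_myers e_simple e_regular e_connected
      (@inf_kappa_le R T e D) (x := a) (y := a').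
    rewrite da' => /(_ L_gt0).
    by rewrite mulrAC ler_pM2r // ler_pdivlMr.
  apply: lb_le_inf; first by exists (kappa R e D a b), a, b.
  by move=> _ [x [y [exy ->]]]; exact: Lambda_curved.
split.
  by split=> -[centered h]; split=> //; [exact: sharp_Lambda | exact: Lambda_sharp].
by case=> -[centered h]; apply: curved_triangles => //;
  [exact: sharp_curved | exact: Lambda_curved].
Qed.
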